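(* Let $\phi$ be a flow on $X$. (a) The following conditions are equivalent: (i) The reflexive, transitive relation $\mathcal O\phi$ is closed. (ii) The transitive relation $\mathcal O(\phi^J)$ is closed. (iii) $\mathcal O\phi=\mathcal N\phi$. (iv) $\mathcal O\phi=\mathcal G\phi$. (v) $\mathcal O(\phi^J)=\mathcal G(\phi^J)$. These conditions imply that the equivalence relation $\mathcal O(\phi\cup\phi^{-1})$ is closed, or, equivalently, that $\mathcal O(\phi\cup\phi^{-1})=\mathcal G(\phi\cup\phi^{-1})$. (b) The following are equivalent: (i) $\mathcal O\phi$ is closed and there are no periodic points, i.e. $|\mathcal O(\phi^J)|=\emptyset$. (ii) $\mathcal O\phi$ is closed and all points are wandering, i.e. $|\mathcal N(\phi^J)|=\emptyset$. (iii) $\mathcal O\phi$ is closed and there are no generalized recurrent points, i.e. $|\mathcal G(\phi^J)|=\emptyset$. (iv) $\mathcal O(\phi\cup\phi^{-1})$ is closed and all points are wandering, i.e. $|\mathcal N(\phi^J)|=\emptyset$. (v) $\phi$ is parallelizable.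
   Context: A space is a locally compact, $\sigma$-compact Hausdorff space; $X$ is a space. For a relation $g\subset X\times X$: $|g|=\{x:(x,x)\in g\}$, $g^{-1}$ is the reverse relation, $\mathcal Og=\bigcup_{n\ge1}g^n$ (compositional powers), $\mathcal Ng$ is the closure of $\mathcal Og$ in $X\times X$, and $\mathcal Gg$ is the smallest closed transitive relation on $X$ containing $g$. A flow $\phi:\mathbb R\times X\to X$ is a continuous action of $\mathbb R$, $\phi^t(x)=\phi(t,x)$; for compact $K\subset[0,\infty)$, $\phi^K=\bigcup_{t\in K}\phi^t$ (maps identified with graphs). $I=[0,1]$, $J=[1,2]$. $\mathcal O\phi=\mathcal O(\phi^I)=\bigcup_{t\ge0}\phi^t$, $\mathcal N\phi=\mathcal N(\phi^I)$, $\mathcal G\phi=\mathcal G(\phi^I)$, $\mathcal O(\phi\cup\phi^{-1})=\mathcal O(\phi^I\cup(\phi^I)^{-1})=\bigcup_{t\in\mathbb R}\phi^t$, $\mathcal G(\phi\cup\phi^{-1})=\mathcal G(\phi^I\cup(\phi^I)^{-1})$. ''Closed'' means closed in $X\times X$. $\phi$ is parallelizable if for some space $Y$ there is a homeomorphism $h:X\to\mathbb R\times Y$ with $h(\phi(t,x))=\tau(t,h(x))$ for all $t\in\mathbb R$, $x\in X$, where $\tau(t,(s,y))=(t+s,y)$. *)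

(* Defs.v *)
From HB Require Import structures.
From mathcomp Require Import all_boot all_order all_algebra.
From mathcomp Require Import all_classical all_reals all_analysis.
Set Implicit Arguments.
Unset Strict Implicit.
Unset Printing Implicit Defensive.
Import Order.TTheory GRing.Theory Num.Theory.
Import numFieldNormedType.Exports.
Local Open Scope classical_set_scope.
Local Open Scope relation_scope.
Local Open Scope ring_scope.

Definition sigma_compact (X : topologicalType) :=
  exists2 K : nat -> set X, (forall n, compact (K n)) & \bigcup_n K n = setT.

Definition is_space (X : topologicalType) :=
  [/\ locally_compact [set: X], sigma_compact X & hausdorff_space X].

Section relations.
Variable X : Type.
Implicit Types g h : set (X * X).

Definition graph (f : X -> X) : set (X * X) := [set xy | xy.2 = f xy.1].

Lemma graphE f x y : graph f (x, y) = (y = f x). Proof. by []. Qed.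

Definition rel_reflexive g := forall x, g (x, x).
Definition rel_symmetric g := forall x y, g (x, y) -> g (y, x).
Definition rel_transitive g := forall x y z, g (x, y) -> g (y, z) -> g (x, z).

Definition rel_diag g : set X := [set x | g (x, x)].

Definition rel_pow g (n : nat) : set (X * X) :=
  iter n (fun h => g \; h) (graph id).

(* the relation O g *)
Definition orbit_rel g : set (X * X) :=
  \bigcup_(n in [set n | (1 <= n)%N]) rel_pow g n.

End relations.

Section closed_relations.
Variable X : topologicalType.
Implicit Types g h : set (X * X).

(* the relation N g *)
Definition nonwandering_rel g : set (X * X) := closure (orbit_rel g).

(* the relation G g *)
Definition gen_recurrent_rel g : set (X * X) :=
  smallest [set h | closed h /\ rel_transitive h] g.

Lemma gen_recurrent_rel_closed_transitive g :
  closed (gen_recurrent_rel g) /\ rel_transitive (gen_recurrent_rel g).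
Proof.
split; first by apply: closed_bigI => h [[]].
move=> x y z gxy gyz h hP; have [[_ hT] _] := hP.
exact: hT (gxy h hP) (gyz h hP).
Qed.

End closed_relations.

Section flows.
Variables (R : realType) (X : topologicalType).
Implicit Type phi : R -> X -> X.

Definition is_flow phi :=
  [/\ continuous (fun p : R * X => phi p.1 p.2),
      forall x, phi 0 x = x &
      forall s t x, phi (s + t) x = phi s (phi t x)].

Definition flow_rel phi (K : set R) : set (X * X) :=
  \bigcup_(t in K) graph (phi t).

Definition flowI phi := flow_rel phi `[0, 1].
Definition flowJ phi := flow_rel phi `[1, 2].

(* The relation written as the union of phi and its reverse. *)
Definition flow_sym phi := flowI phi `|` ((flowI phi)^-1)%relation.

Definition translation_flow (Y : Type) (t : R) (p : R * Y) : R * Y :=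
  (t + p.1, p.2).

Definition parallelizable phi :=
  exists2 Y : topologicalType, is_space Y &
  exists (h : X -> R * Y) (k : R * Y -> X),
    [/\ cancel h k, cancel k h, continuous h, continuous k &
        forall t x, h (phi t x) = translation_flow t (h x)].

End flows.

Section orbit_relations.

Lemma rel_pow_trans (X : Type) (g : set (X * X)) m n x y z :
  rel_pow g m (x, y) -> rel_pow g n (y, z) -> rel_pow g (n + m) (x, z).
Proof.
move=> gxy; elim: n z => [z /=|n IH z /= [w /IH gxw gwz]].
  by rewrite graphE => ->.
by exists w.
Qed.

Lemma orbit_rel_transitive (X : Type) (g : set (X * X)) :
  rel_transitive (orbit_rel g).
Proof.
move=> x y z [m /= m0 gxy] [n /= n0 gyz]; exists (n + m)%N => /=.
  by rewrite addn_gt0 n0.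
exact: rel_pow_trans gxy gyz.
Qed.

Lemma sub_orbit_rel (X : Type) (g : set (X * X)) : g `<=` orbit_rel g.
Proof. by move=> [x y] gxy; exists 1%N => //=; exists x. Qed.

Lemma orbit_rel_min (X : Type) (g h : set (X * X)) :
  g `<=` h -> rel_transitive h -> orbit_rel g `<=` h.
Proof.
move=> gh hT [x y] [[//|n] _]; elim: n y => [y /= [z /=]|n IH y].
  by rewrite graphE => -> /gh.
by move=> [z /IH hxz /gh]; exact: hT hxz.
Qed.

Variables (R : realType) (X : topologicalType) (phi : R -> X -> X).
Hypothesis phiF : is_flow phi.

Let orbit_rel_flow_natmul (t : R) n x : 0 <= t <= 1 ->
  orbit_rel (flowI phi) (x, phi (t *+ n.+1) x).
Proof.
move=> t01; have tI y : flowI phi (y, phi t y) by exists t => //=; rewrite in_itv.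
elim: n => [|n IH]; first exact: sub_orbit_rel.
case: phiF => _ _ phiD; rewrite mulrS phiD.
by apply: orbit_rel_transitive IH _; exact: sub_orbit_rel.
Qed.

Lemma orbit_rel_flowE :
  orbit_rel (flowI phi) = \bigcup_(t in [set t | 0 <= t]) graph (phi t).
Proof.
case: (phiF) => _ phi0 phiD; apply/seteqP; split.
  apply: orbit_rel_min.
    by move=> p [t /=]; rewrite in_itv => /andP[t0 _] pt; exists t.
  move=> x y z [s /= s0]; rewrite graphE => -> [t /= t0]; rewrite graphE => ->.
  by exists (t + s) => /=; [exact: addr_ge0|rewrite graphE phiD].
move=> [x y] [t /= t0]; rewrite graphE => ->.
have n0 : 0 < (Num.truncn t).+1%:R :> R by rewrite ltr0n.
have -> : t = (t / (Num.truncn t).+1%:R) *+ (Num.truncn t).+1.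
  by rewrite -mulr_natr divfK// gt_eqF.
apply: orbit_rel_flow_natmul; apply/andP; split; first exact/divr_ge0/ltW.
by rewrite ler_pdivrMr// mul1r ltW// truncnS_gt.
Qed.

Lemma orbit_rel_flow_symE :
  orbit_rel (flow_sym phi) = \bigcup_t graph (phi t).
Proof.
case: (phiF) => _ phi0 phiD.
have phiN t x : phi (- t) (phi t x) = x by rewrite -phiD addNr phi0.
apply/seteqP; split.
  apply: orbit_rel_min.
    move=> [x y] [[t _ pt]|[t _ /=]]; first by exists t.
    by rewrite graphE => ->; exists (- t) => //=; rewrite graphE phiN.
  move=> x y z [s _]; rewrite graphE => -> [t _]; rewrite graphE => ->.
  by exists (t + s) => //; rewrite graphE phiD.
have pos s x : 0 <= s ->
    orbit_rel (flow_sym phi) (x, phi s x) /\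
    orbit_rel (flow_sym phi) (phi s x, x).
  move=> s0; have : orbit_rel (flowI phi) (x, phi s x).
    by rewrite orbit_rel_flowE; exists s.
  pose h := orbit_rel (flow_sym phi); move: (x) (phi s x) => a b oab.
  suff : (h `&` (h^-1)%relation) (a, b) by [].
  move: (a, b) oab; apply: orbit_rel_min.
    by move=> p ?; split; apply: sub_orbit_rel; [left|right].
  move=> u v w [uv vu] [vw wv].
  by split; [apply: orbit_rel_transitive uv vw|apply: orbit_rel_transitive wv vu].
move=> [x y] [t _]; rewrite graphE => ->.
have [t0|/ltW t0] := leP 0 t; first by have [] := pos t x t0.
have t0' : 0 <= - t by rewrite oppr_ge0.
by have [_] := pos (- t) (phi t x) t0'; rewrite phiN.
Qed.

Lemma orbit_rel_flow_reflexive : rel_reflexive (orbit_rel (flowI phi)).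
Proof.
by case: (phiF) => _ phi0 _ x; rewrite orbit_rel_flowE; exists 0 => //=.
Qed.

Lemma orbit_rel_flow_sym_equiv :
  [/\ rel_reflexive (orbit_rel (flow_sym phi)),
      rel_symmetric (orbit_rel (flow_sym phi)) &
      rel_transitive (orbit_rel (flow_sym phi))].
Proof.
case: (phiF) => _ phi0 phiD; split; last exact: orbit_rel_transitive.
  by move=> x; rewrite orbit_rel_flow_symE; exists 0 => //=; rewrite graphE phi0.
move=> x y; rewrite orbit_rel_flow_symE => -[t _]; rewrite graphE => ->.
by exists (- t) => //; rewrite graphE -phiD addNr phi0.
Qed.

End orbit_relations.

(* Main.v *)
(* The hard implication is (b)(iv) => (v).  Wandering together with closedness of
   the orbit equivalence relation makes the action proper: for compact A and B
   the times t such that phi^t A meets B are bounded.  Take bump functions g_n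
   with compact supports, S_n the union of the first n + 1 supports, and T_n a
   bound for the times t such that phi^t S_n meets S_n.  Then
     E x = sup_(n, s) exp (s - T_n - n) * g_n (phi^s x)
   is positive, continuous and satisfies E (phi^t x) = exp (- t) * E x, so that
   L = - ln E satisfies L (phi^t x) = L x + t.  Its zero set is a global section
   of the flow, and x |-> (L x, phi^(- L x) x) trivializes the flow. *)
Require Import Defs.
From mathcomp Require Import all_boot all_order all_algebra.
From mathcomp Require Import all_classical all_reals all_analysis.
From mathcomp Require Import lra.
Set Implicit Arguments.
Unset Strict Implicit.
Unset Printing Implicit Defensive.
Import Order.TTheory GRing.Theory Num.Theory.
Import numFieldNormedType.Exports.
Local Open Scope classical_set_scope.
Local Open Scope ring_scope.

(** * Closed orbit relations, and the orbit relation of [flowJ] *)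

(** The orbit relation is the least transitive relation containing [g], so it lies in
    [gen_recurrent_rel g]; once closed, it also takes part in the intersection defining the
    latter. *)
Lemma orbit_rel_closedP (X : topologicalType) (g : set (X * X)) :
  closed (orbit_rel g) <-> orbit_rel g = gen_recurrent_rel g.
Proof.
have [Gc Gt] := gen_recurrent_rel_closed_transitive g.
split=> [oc|->//]; apply/seteqP; split.
  by apply: orbit_rel_min Gt; exact: sub_gen_smallest.
apply: smallest_sub; last exact: sub_orbit_rel.
by split=> //; exact: orbit_rel_transitive.
Qed.

Section flow_relations.
Variables (R : realType) (X : topologicalType) (phi : R -> X -> X).
Hypothesis phiF : is_flow phi.

Lemma flow_continuous (Z : topologicalType) (a : Z -> R) (b : Z -> X) :
  continuous a -> continuous b -> continuous (fun z => phi (a z) (b z)).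
Proof.
move=> ca cb z; case: phiF => cphi _ _.
exact: (continuous2_cvg _ (cphi (a z, b z)) (ca z) (cb z)).
Qed.

Lemma flowNK t x : phi (- t) (phi t x) = x.
Proof. by case: phiF => _ phi0 phiD; rewrite -phiD addNr phi0. Qed.

Let orbit_rel_flowJ_natmul (t : R) n x : 1 <= t <= 2 ->
  orbit_rel (flowJ phi) (x, phi (t *+ n.+1) x).
Proof.
move=> t12; have tJ y : flowJ phi (y, phi t y) by exists t => //=; rewrite in_itv.
elim: n => [|n IH]; first exact: sub_orbit_rel.
case: phiF => _ _ phiD; rewrite mulrS phiD.
by apply: orbit_rel_transitive IH _; exact: sub_orbit_rel.
Qed.

(** A time [t >= 1] with integer part [m >= 1] splits into [m] equal steps lying in [1, 2], because
    [m <= t < m + 1 <= 2 m]. *)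
Lemma orbit_rel_flowJE :
  orbit_rel (flowJ phi) = \bigcup_(t in [set t | 1 <= t]) graph (phi t).
Proof.
case: (phiF) => _ phi0 phiD; apply/seteqP; split.
  apply: orbit_rel_min.
    by move=> p [t /=]; rewrite in_itv => /andP[t0 _] pt; exists t.
  move=> x y z [s /= s1]; rewrite graphE => -> [t /= t1]; rewrite graphE => ->.
  by exists (t + s) => /=; [lra|rewrite graphE phiD].
move=> [x y] [t /= t1]; rewrite graphE => ->.
have t0 : 0 <= t by exact: le_trans t1.
have /andP[] := truncn_itv t0.
case: (Num.truncn t) => [_ /(le_lt_trans t1)|n tn tn1]; first by rewrite ltxx.
have n0 : 0 < n.+1%:R :> R by rewrite ltr0n.
have -> : t = (t / n.+1%:R) *+ n.+1 by rewrite -mulr_natr divfK// gt_eqF.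
apply: orbit_rel_flowJ_natmul; rewrite ler_pdivlMr// mul1r tn/= ler_pdivrMr//.
apply: (le_trans (ltW tn1)).
by rewrite -natrM ler_nat mul2n -addnn addnS !ltnS leq_addr.
Qed.

End flow_relations.

(** * Topological tools: suprema, bump functions, product neighbourhoods *)

(** Lower semicontinuity is automatic: a single nearly optimal index at [x] stays nearly optimal
    nearby. The last hypothesis supplies upper semicontinuity, uniformly in the index. *)
Lemma sup_continuous_at (R : realType) (X : topologicalType) (I : Type)
    (v : I -> X -> R) (x : X) (i0 : I) :
  (forall i, {for x, continuous (v i)}) -> has_ubound (range (v^~ x)) ->
  (forall e, 0 < e ->
     \forall y \near x, forall i, v i y <= sup (range (v^~ x)) + e) ->
  {for x, continuous (fun y => sup (range (v^~ y)))}.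
Proof.
move=> cv ubx usc; apply/cvgrPdist_le => /= e e0.
have e20 : 0 < e / 2 by rewrite divr_gt0.
have [_ [i _ <-] vi] :
    exists2 r, range (v^~ x) r & sup (range (v^~ x)) - e / 2 < r.
  by apply: sup_adherent => //; split=> //; exists (v i0 x), i0.
near=> y.
have le_y j : v j y <= sup (range (v^~ x)) + e by move: j; near: y; exact: usc.
rewrite distrC ler_distl; apply/andP; split; last first.
  by apply: ge_sup; [exists (v i0 y), i0|move=> _ [j _ <-]].
(* The uniform bound near [x] also makes the family bounded at [y], so its [sup] is a genuine
   supremum. *)
have vy : v i y <= sup (range (v^~ y)).
  by apply: ub_le_sup; [exists (sup (range (v^~ x)) + e) => _ [j _ <-]|exists i].
apply: le_trans vy; have : `|v i x - v i y| <= e / 2.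
  by near: y; move/cvgrPdist_le: (cv i); exact.
by rewrite ler_distl => /andP[_]; lra.
Unshelve. all: by end_near. Qed.

(** The one-point compactification is compact Hausdorff, hence normal. Urysohn separates infinity
    from [K], and truncation at height 1/2 produces compact support. *)
Lemma compact_bump (R : realType) (X : topologicalType) (K : set X) :
  locally_compact [set: X] -> hausdorff_space X -> compact K ->
  exists (g : X -> R) (C : set X), [/\ continuous g, compact C,
    forall x, 0 <= g x <= 1, forall x, g x != 0 -> C x &
    forall x, K x -> 0 < g x].
Proof.
move=> lcX hX cK; pose opc := one_point_compactification X.
have hopc : hausdorff_space opc by exact: one_point_compactification_hausdorff.
have Some_cont : continuous (Some : X -> opc).
  exact: one_point_compactification_some_continuous.
have clK : closed (Some @` K : set opc).
  apply: compact_closed => //; apply: continuous_compact => //.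
  exact/continuous_subspaceT.
have clN : closed [set (None : opc)].
  exact/accessible_closed_set1/hausdorff_accessible.
have /(@uniform_separatorP _ R)[f [cf f01 f0 f1]] :
    uniform_separator [set (None : opc)] (Some @` K : set opc).
  apply: (@normal_separatorP R opc).1 => //.
    exact/compact_normal/one_point_compactification_compact.
  by apply/seteqP; split=> // _ [-> [? _]].
have fN : f None = 0 by apply: f0; exists None.
have f01' z : 0 <= f z <= 1.
  by have /= := f01 (f z); rewrite in_itv; apply; exists z.
(* A neighbourhood of infinity contains the complement of a compact [C], so [f] is below 1/2 off
   [C]. *)
have /cf[C [cC _] CP] : nbhs (f None) [set r : R | r < 2^-1].
  by rewrite fN; apply: lt_nbhsl; rewrite invr_gt0.
exists (fun x => Num.max 0 (f (Some x) - 2^-1)), C; split => //.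
- apply: (@max_fun_continuous _ X R (fun=> 0)) => x; first exact: cvg_cst.
  apply: cvgB; last exact: cvg_cst.
  exact: (continuous_comp (Some_cont x) (cf _)).
- move=> x; have := f01' (Some x).
  by rewrite le_max lexx ge_max ler01/=; lra.
- move=> x; apply: contra_neqP => Cx; apply/max_idPl.
  suff : f (Some x) < 2^-1 by lra.
  by apply: (CP (Some x)); left; exists x.
- move=> x Kx; rewrite lt_max ltxx /= (f1 (f (Some x))); first lra.
  by exists (Some x) => //; exists x.
Qed.

Lemma closed_setC_nbhsX (X Y : topologicalType) (A : set (X * Y)) x y :
  closed A -> ~ A (x, y) -> exists U V,
    [/\ nbhs x U, nbhs y V & forall a b, U a -> V b -> ~ A (a, b)].
Proof.
move=> cA nA; have [[U V] /= [Ux Vy] UV] : nbhs (x, y) (~` A).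
  by apply: open_nbhs_nbhs; split=> //; exact: closed_openC.
by exists U, V; split=> // a b Ua Vb; exact: (UV (a, b)).
Qed.

(** * Properness of the flow *)

Section proper_flow.
Variables (R : realType) (X : topologicalType) (phi : R -> X -> X).
Hypothesis phiF : is_flow phi.
Hypothesis closedO : closed (orbit_rel (flow_sym phi)).
Hypothesis wandering : rel_diag (nonwandering_rel (flowJ phi)) = set0.

Let flowD s t x : phi (s + t) x = phi s (phi t x).
Proof. by case: phiF. Qed.

(** Local properness. If [y] is off the orbit of [x], closedness excludes every connecting time
    nearby; if [y = phi r x], pulling [y'] back by [phi (- r)] turns a connection into a return near
    [x], which wandering forbids for long times. *)
Lemma wandering_return_time (x y : X) : exists T : R, \forall x' \near x & y' \near y,
  forall s, phi s x' = y' -> `|s| <= T.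
Proof.
have [[r yE]|nxy] := pselect (exists r, y = phi r x); last first.
  have [|U [V [Ux Vy UV]]] := closed_setC_nbhsX (x := x) (y := y) closedO.
    by rewrite orbit_rel_flow_symE// => -[r _ ?]; apply: nxy; exists r.
  (* Any bound works, as no orbit joins [U] to [V]. *)
  exists 0; exists (U, V) => // -[x' y'] /= [Ux' Vy'] s sE.
  by have [] := UV _ _ Ux' Vy'; rewrite orbit_rel_flow_symE//; exists s.
have [|U [V [Ux Vx UVN]]] :=
    closed_setC_nbhsX (x := x) (y := x)
      (@closed_closure _ (orbit_rel (flowJ phi))).
  by move=> Nx; have : set0 x by rewrite -wandering.
have UVO a b : U a -> V b -> ~ orbit_rel (flowJ phi) (a, b).
  by move=> Ua Vb /subset_closure; exact: UVN.
exists (`|r| + 1).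
have ret : \forall y' \near y, (U `&` V) (phi (- r) y').
  have : {for y, continuous (phi (- r))}.
    apply: (flow_continuous phiF (a := fun=> - r) (b := id)) => ?.
      exact: cvg_cst.
    exact: cvg_id.
  by apply; rewrite yE flowNK//; exact: filterI.
exists (U `&` V, [set y' | (U `&` V) (phi (- r) y')]).
  by split=> //; exact: filterI.
move=> [x' y'] /= [[Ux' Vx'] [Uy' Vy']] s sE; rewrite leNgt; apply/negP => rs.
have y'E : phi (- r) y' = phi (s - r) x' by rewrite -sE addrC flowD.
(* Since [phi (s - r)] maps [x'] to [phi (- r) y'], the two signs give forbidden passages from [U]
   to [V] in opposite directions; hence both points are kept in the intersection of [U] and [V]. *)
have : 1 <= s - r \/ 1 <= - (s - r).
  by move: rs; case: (ler0P r) => ?; case: (ler0P s) => ?; lra.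
rewrite orbit_rel_flowJE// in UVO => -[sr|sr].
  by apply: (UVO _ _ Ux' Vy'); exists (s - r).
by apply: (UVO _ _ Uy' Vx'); exists (- (s - r)) => //; rewrite graphE y'E flowNK.
Qed.

(** The local bounds are made uniform by near-coverings, first over [B] and then over [A]; the bound
    itself is a parameter tending to [+oo]. *)
Lemma wandering_proper (A B : set X) : compact A -> compact B ->
  exists T : R, forall x s, A x -> B (phi s x) -> `|s| <= T.
Proof.
move=> /compact_near_coveringP cA /compact_near_coveringP cB.
have {cB}AB x : A x -> \forall x' \near x & T \near +oo,
    forall s, B (phi s x') -> `|s| <= T.
  move=> _; have := cB (X * R)%type (filter_prod (nbhs x) (pinfty_nbhs R))
    (fun i y => forall s, phi s i.1 = y -> `|s| <= i.2) _.
  move=> /(_ _) H; apply: filterS (H _); first by move=> i iB s /iB; exact.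
  move=> y _; have [T [[U V] /= [Ux Vy] UV]] := wandering_return_time x y.
  exists (V, U `*` [set t | T <= t]) => /=.
    split=> //; exists (U, [set t | T <= t]) => //; split=> //=.
    by apply: nbhs_pinfty_ge; rewrite num_real.
  move=> [y' [x' t]] /= [Vy' [Ux' Tt]] s sE.
  by apply: le_trans Tt; exact: (UV (x', y')).
have [T TP] := filter_ex (cA R (pinfty_nbhs R)
  (fun T x => forall s, B (phi s x) -> `|s| <= T) _ AB).
by exists T => x s Ax; exact: TP.
Qed.

End proper_flow.

(** * Construction of a function that grows by [t] along the flow *)

Lemma compact_bump_sequence (R : realType) (X : topologicalType) :
  is_space X -> exists (g : nat -> X -> R) (S : nat -> set X),
    [/\ forall n, continuous (g n), forall n x, 0 <= g n x <= 1,
        forall x, exists n, 0 < g n x &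
        [/\ forall n, compact (S n), {homo S : m n / (m <= n)%N >-> m `<=` n} &
            forall n x, g n x != 0 -> S n x]].
Proof.
case=> lcX [K cK KT] hX.
have /choice[gC gCP] n : exists gC : (X -> R) * set X, [/\ continuous gC.1,
    compact gC.2, forall x, 0 <= gC.1 x <= 1, forall x, gC.1 x != 0 -> gC.2 x &
    forall x, K n x -> 0 < gC.1 x].
  by have [g [C gC]] := compact_bump R lcX hX (cK n); exists (g, C).
(* Accumulated supports increase with [n], so any two of them lie in the one of larger index. *)
exists (fun n => (gC n).1), (fun n => \big[setU/set0]_(i < n.+1) (gC i).2).
split.
- by move=> n; case: (gCP n).
- by move=> n; case: (gCP n).
- move=> x; have [n _ Knx] : (\bigcup_n K n) x by rewrite KT.
  by exists n; case: (gCP n) => _ _ _ _; exact.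
- split.
  + move=> n; apply: (@bigsetU_compact X _ _ _ xpredT) => i _.
    by case: (gCP i).
  + move=> m n mn.
    exact: (@subset_bigsetU _ (fun i => (gC i).2) m.+1 n.+1).
  + move=> n x gx; apply: (@bigsetU_sup _ n n.+1 (fun i => (gC i).2)) => //.
    by case: (gCP n) => _ _ _ + _; exact.
Qed.

Lemma proper_flow_equivariant_fun (R : realType) (X : topologicalType)
    (phi : R -> X -> X) : is_space X -> is_flow phi ->
  (forall A B, compact A -> compact B ->
     exists T : R, forall x s, A x -> B (phi s x) -> `|s| <= T) ->
  exists2 L : X -> R, continuous L & forall t x, L (phi t x) = L x + t.
Proof.
move=> spaceX phiF phi_proper; have [cphi phi0 phiD] := phiF.
have [g [S [cg g01 g_gt0 [cS ndS gS]]]] := compact_bump_sequence R spaceX.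
have /choice[T TP] n : exists T : R, forall x s, S n x -> S n (phi s x) -> `|s| <= T.
  exact: phi_proper.
(* The factor [expR s] creates the equivariance, [- T n] offsets its growth over the times allowed
   by properness, and [- n] makes the terms of large index small. *)
pose v (i : nat * R) x : R := expR (i.2 - T i.1 - i.1%:R) * g i.1 (phi i.2 x).
pose E x := sup (range (v^~ x)).
have T_ge0 n x : S n x -> 0 <= T n.
  by move=> Sx; rewrite -(normr0 R); apply: (TP n x) => //; rewrite phi0.
have v_ge0 i x : 0 <= v i x.
  by apply: mulr_ge0; [exact: expR_ge0|case/andP: (g01 i.1 (phi i.2 x))].
have v_le i x : v i x <= expR (i.2 - T i.1 - i.1%:R).
  rewrite -[leRHS]mulr1; apply: ler_wpM2l; first exact: expR_ge0.
  by case/andP: (g01 i.1 (phi i.2 x)).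
have v_neq0 i x : v i x != 0 -> S i.1 (phi i.2 x).
  by rewrite mulf_eq0 negb_or => /andP[_ /gS].
(* Both [x] and [phi i.2 x] lie in the support set of index [maxn j i.1], where the return times are
   bounded. *)
have v_supp j i x : S j x -> v i x != 0 -> `|i.2| <= T (maxn j i.1).
  move=> Sx /v_neq0 Sy; apply: (TP _ x).
    by apply: ndS Sx; exact: leq_maxl.
  by apply: ndS Sy; exact: leq_maxr.
have v_small j i x : S j x -> (j <= i.1)%N -> v i x <= expR (- i.1%:R).
  move=> Sx ji; have [->|v0] := eqVneq (v i x) 0; first exact: expR_ge0.
  apply: le_trans (v_le _ _) _; rewrite ler_expR.
  have := v_supp _ _ _ Sx v0; rewrite (maxn_idPr ji).
  by have := ler_norm i.2; lra.
(* For indices below [j], a nonzero term has time at most [T j], and the subtracted quantities are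
   nonnegative. *)
have v_bound j i x : S j x -> v i x <= expR (T j).
  move=> Sx; have Tj := T_ge0 _ _ Sx.
  have [ji|ij] := leqP j i.1.
    apply: le_trans (v_small _ _ _ Sx ji) _; rewrite ler_expR.
    by have := ler0n R i.1; lra.
  have [->|v0] := eqVneq (v i x) 0; first exact: expR_ge0.
  apply: le_trans (v_le _ _) _; rewrite ler_expR.
  have := v_supp _ _ _ Sx v0; rewrite (maxn_idPl (ltnW ij)).
  have := T_ge0 _ _ (v_neq0 _ _ v0).
  by have := ler_norm i.2; have := ler0n R i.1; lra.
have nbhsS (x : X) : exists j, \forall y \near x, S j y.
  have [j gj] := g_gt0 x; exists j.
  have : \forall y \near x, 0 < g j y by have /(cg j x) := lt_nbhsr gj.
  by apply: filterS => y gy; apply: gS; rewrite gt_eqF.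
have v_ub x : has_ubound (range (v^~ x)).
  have [j /nbhs_singleton Sx] := nbhsS x.
  by exists (expR (T j)) => _ [i _ <-]; exact: v_bound.
have vE i x : v i x <= E x by apply: ub_le_sup => //; exists i.
have cv n : continuous (fun p : R * X => v (n, p.1) p.2).
  move=> p; apply: cvgM.
    apply: (@continuous_comp _ _ _ (fun p : R * X => p.1 - T n - n%:R));
      last exact: continuous_expR.
    apply: cvgB; last exact: cvg_cst.
    by apply: cvgB; [exact: cvg_fst|exact: cvg_cst].
  apply: (@continuous_comp _ _ _ (fun p : R * X => phi p.1 p.2));
    last exact: cg.
  exact: cphi.
have cvi i : continuous (v i).
  case: i => n s x.
  exact: (@continuous2_cvg _ _ _ _ _ _ (fun=> s) id (fun s x => v (n, s) x) s x
    (cv n (s, x)) (cvg_cst _) cvg_id).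
have cE : continuous E.
  move=> x; apply: (sup_continuous_at (0%N, 0)) => // [i|e e0]; first exact: cvi.
  have [j Sj] := nbhsS x.
  (* Near [x], all terms of index at least [N] are at most [e] by [v_small]; only finitely many
     indices remain. *)
  have [N jN Ne] : exists2 N, (j <= N)%N & expR (- N%:R) <= e.
    have [N [jN Ne]] : exists N, (j <= N)%N /\ - ln e < N%:R.
      apply: (@filter_ex _ \oo); apply: filterI; first exact: nbhs_infty_ge.
      exact: nbhs_infty_gtr.
    by exists N => //; rewrite -[leRHS]lnK ?ler_expR; [lra|].
  (* For fixed [n], the terms vanish near [x] at times outside [[- M, M]], and compactness of this
     segment makes the estimate uniform in [s]. *)
  have vN n : \forall y \near x, forall s, v (n, s) y <= E x + e.
    pose M := T (maxn j n).
    have : \forall y \near x, `[- M, M] `<=` [set s | v (n, s) y <= E x + e].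
      have /compact_near_coveringP cM := @segment_compact R (- M) M.
      apply: (cM X (nbhs x) (fun y s => v (n, s) y <= E x + e)) => s _.
      have : v (n, s) x < E x + e by have := vE (n, s) x; lra.
      move=> /lt_nbhsl/(cv n (s, x)).
      exact: (@filterS _ (nbhs (s, x)) _ _ _ (fun p => @ltW _ _ _ _)).
    apply: filterS2 Sj => y Sy yM s.
    have [v0|/(v_supp _ _ _ Sy)] := eqVneq (v (n, s) y) 0.
      by have := vE (0%N, 0) x; have := v_ge0 (0%N, 0) x; lra.
    by rewrite ler_norml => sM; apply: yM; rewrite /= in_itv.
  have vNs : \forall y \near x, forall n, (n < N)%N ->
      forall s, v (n, s) y <= E x + e.
    elim: (N) => [|m IH]; first by near=> y.
    apply: filterS2 IH (vN m) => y IH vm n.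
    by rewrite ltnS leq_eqVlt => /predU1P[->|/IH].
  apply: filterS2 Sj vNs => y Sy vNs [n s].
  have [Nn|/vNs//] := leqP N n.
  apply: (le_trans (v_small j (n, s) y Sy _)) => /=; first exact: leq_trans Nn.
  have NE : expR (- n%:R) <= expR (- N%:R) :> R.
    by rewrite ler_expR lerN2 ler_nat.
  by have := vE (0%N, 0) x; have := v_ge0 (0%N, 0) x; rewrite -/(E x); lra.
have E_gt0 x : 0 < E x.
  have [n gn] := g_gt0 x; apply: lt_le_trans (vE (n, 0) x).
  by rewrite mulr_gt0 ?expR_gt0//= phi0.
have E_le t x : E (phi t x) <= expR (- t) * E x.
  apply: ge_sup => [|_ [[n s] _ <-]].
    by exists (v (0%N, 0) (phi t x)), (0%N, 0).
  (* Moving the base point by [t] only shifts the time index of the family. *)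
  have -> : v (n, s) (phi t x) = expR (- t) * v (n, s + t) x.
    rewrite /v /= mulrA -expRD phiD; congr (expR _ * _); lra.
  by apply: ler_wpM2l; [exact: expR_ge0|exact: vE].
have ED t x : E (phi t x) = expR (- t) * E x.
  (* The reverse inequality is [E_le] at time [- t] from the point [phi t x]. *)
  apply/eqP; rewrite eq_le E_le/= -{1}(flowNK phiF t x).
  apply: le_trans (ler_wpM2l (expR_ge0 _) (E_le _ _)) _.
  by rewrite mulrA -expRD opprK addNr expR0 mul1r.
exists (fun x => - ln (E x)).
  by move=> x; apply: cvgN; apply: continuous_comp; [exact: cE|exact: continuous_ln].
by move=> t x; rewrite ED lnM ?posrE ?expR_gt0// expRK opprD opprK addrC.
Unshelve. all: by end_near. Qed.

(** * Trivialization along a global section *)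

Lemma inj_continuous_hausdorff (X Y : topologicalType) (f : X -> Y) :
  continuous f -> injective f -> hausdorff_space Y -> hausdorff_space X.
Proof.
move=> cf injf hY x y xy; apply/injf/hY => A B /cf fA /cf fB.
by have [z [Az Bz]] := xy _ _ fA fB; exists (f z).
Qed.

(** Each orbit meets the zero set of [L] exactly once, at time [- L x] from [x]. The resulting map
    [q] is a flow-invariant retraction onto that set, which becomes the factor [Y]. *)
Lemma equivariant_fun_parallelizable (R : realType) (X : topologicalType)
    (phi : R -> X -> X) (L : X -> R) :
  is_space X -> is_flow phi -> continuous L ->
  (forall t x, L (phi t x) = L x + t) -> parallelizable phi.
Proof.
move=> [lcX [K cK KT] hX] phiF cL LD; have [cphi phi0 phiD] := phiF.
pose Z := [set x | L x = 0]; pose p x := phi (- L x) x.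
have pZ x : p x \in Z by apply/mem_set; rewrite /Z /= LD subrr.
pose q x : Z := exist _ (p x) (pZ x).
have cval : continuous (\val : Z -> X) by exact: initial_continuous.
have cq : continuous q.
  apply: continuous_comp_initial.
  apply: (flow_continuous phiF (a := fun x => - L x) (b := id)) => x.
    by apply: cvgN; exact: cL.
  exact: cvg_id.
have qK (z : Z) : q (\val z) = z.
  by apply: val_inj; rewrite /= /p (set_valP z : L (\val z) = 0) oppr0 phi0.
have qphi t x : q (phi t x) = q x.
  apply: val_inj; rewrite /= /p LD -phiD; congr (phi _ _); lra.
have hZ : hausdorff_space Z by exact: inj_continuous_hausdorff cval val_inj hX.
have cqC (C : set X) : compact C -> compact (q @` C).
  exact/continuous_compact/continuous_subspaceT.
(* Since [q] fixes [Z], the image of a compact [C] is compact and contains the points of [Z] in [C];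
   this carries both compactness properties from [X] to [Z]. *)
have spaceZ : is_space Z.
  split.
  - move=> z _; have [C + [cC _]] := lcX (\val z) I.
    rewrite withinET => /cval Cz; exists (q @` C).
      rewrite withinET; apply: (@filterS _ (nbhs z) _ _ _ _ Cz) => w Cw.
      by exists (\val w).
    by split; [exact: cqC|apply: compact_closed => //; exact: cqC].
  - exists (fun n => q @` K n).
      by move=> n; exact: cqC.
    apply/seteqP; split=> // z _.
    have [n _ Kz] : (\bigcup_n K n) (\val z) by rewrite KT.
    by exists n => //; exists (\val z).
  - by [].
exists Z => //; exists (fun x => (L x, q x)), (fun ty => phi ty.1 (\val ty.2)).
split.
- by move=> x /=; rewrite -phiD subrr phi0.
- move=> [t z] /=; rewrite LD (set_valP z : L (\val z) = 0) add0r.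
  by rewrite qphi qK.
- by move=> x; exact: cvg_pair (cL x) (cq x).
- apply: (flow_continuous phiF) => tz; first exact: cvg_fst.
  apply: (@continuous_comp _ _ _ snd (\val : Z -> X)); first exact: cvg_snd.
  exact: cval.
- by move=> t x; rewrite /translation_flow /= qphi LD addrC.
Qed.

(** * Relations between the closedness conditions and parallelizability *)

Section closed_orbit_relations.
Variables (R : realType) (X : topologicalType) (phi : R -> X -> X).
Hypothesis phiF : is_flow phi.

(** The relations consist of the times [t >= 0] and [t >= 1]; shifting the second coordinate by
    [phi (- 1)] or [phi 1] exhibits each as a continuous preimage of the other. *)
Lemma closed_orbit_flowJ :
  closed (orbit_rel (flowI phi)) <-> closed (orbit_rel (flowJ phi)).
Proof.
have [_ _ phiD] := phiF.
have cT t : continuous (fun p : X * X => (p.1, phi t p.2)).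
  move=> p; apply: cvg_pair => /=; first exact: cvg_fst.
  apply: (flow_continuous phiF (a := fun=> t)) => ?; first exact: cvg_cst.
  exact: cvg_snd.
have IJ : orbit_rel (flowJ phi) =
    (fun p => (p.1, phi (- 1) p.2)) @^-1` orbit_rel (flowI phi).
  rewrite orbit_rel_flowJE// orbit_rel_flowE//; apply/seteqP.
  split=> -[x y] [t /= t1]; rewrite graphE.
    by move=> ->; exists (t - 1) => /=; [lra|rewrite graphE addrC phiD].
  move=> yE; exists (1 + t) => /=; first lra.
  by rewrite graphE phiD -yE -{1}[1]opprK flowNK.
have JI : orbit_rel (flowI phi) =
    (fun p => (p.1, phi 1 p.2)) @^-1` orbit_rel (flowJ phi).
  by rewrite IJ; apply/seteqP; split=> -[x y] /=; rewrite flowNK.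
split=> cO; first by rewrite IJ; exact: (continuous_closedP _).1 (cT _) _ cO.
by rewrite JI; exact: (continuous_closedP _).1 (cT _) _ cO.
Qed.

(** Splitting times by sign writes the relation as the union of the forward orbit relation and its
    image under the coordinate swap. *)
Lemma closed_orbit_flow_sym :
  closed (orbit_rel (flowI phi)) -> closed (orbit_rel (flow_sym phi)).
Proof.
move=> cO; have [_ _ phiD] := phiF.
have -> : orbit_rel (flow_sym phi) =
    orbit_rel (flowI phi) `|` (fun p => (p.2, p.1)) @^-1` orbit_rel (flowI phi).
  rewrite orbit_rel_flow_symE// orbit_rel_flowE//; apply/seteqP.
  split=> [[x y] [t _]|[x y] [[t /= t0]|[t /= t0]]]; rewrite !graphE.
  - move=> ->; have [t0|/ltW t0] := leP 0 t; first by left; exists t.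
    by right; exists (- t); rewrite /= ?oppr_ge0// graphE flowNK.
  - by move=> ->; exists t.
  - by move=> ->; exists (- t) => //; rewrite graphE flowNK.
apply: closedU => //.
exact: (continuous_closedP _).1 swap_continuous _ cO.
Qed.

(** In product coordinates the relation says that the [Y] components agree and the real component
    does not decrease, both closed conditions as [Y] is Hausdorff. *)
Lemma parallelizable_closed_orbit :
  parallelizable phi -> closed (orbit_rel (flowI phi)).
Proof.
case=> Y [_ _ hY] [h [k [hK _ ch _ hphi]]].
have OE x y : orbit_rel (flowI phi) (x, y) <->
    (h x).2 = (h y).2 /\ 0 <= (h y).1 - (h x).1.
  rewrite orbit_rel_flowE//; split=> [[t /= t0]|[h2 h1]].
    by rewrite graphE => ->; rewrite hphi /= addrK.
  exists ((h y).1 - (h x).1) => //; rewrite graphE; apply: (can_inj hK).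
  by rewrite hphi /translation_flow subrK h2; case: (h y).
have c1 : continuous (fun p : X * X => (h p.2).1 - (h p.1).1).
  move=> p; apply: cvgB.
    apply: (@continuous_comp _ _ _ (h \o snd) fst); last exact: cvg_fst.
    by apply: continuous_comp; [exact: cvg_snd|exact: ch].
  apply: (@continuous_comp _ _ _ (h \o fst) fst); last exact: cvg_fst.
  by apply: continuous_comp; [exact: cvg_fst|exact: ch].
have c2 : continuous (snd \o h).
  by move=> x; apply: continuous_comp; [exact: ch|exact: cvg_snd].
move=> [x y] clO; apply/OE; split; last first.
  apply: ((continuous_closedP _).1 c1 _ (@closed_ge _ 0) (x, y)).
  by apply: closureS clO => -[a b] /OE[].
(* Neighbourhoods of the two [Y] components pull back to a neighbourhood of [(x, y)]; an orbit pair
   there has a common component in both. *)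
apply: hY => A B /c2 Ax /c2 By.
have [[a b] [/OE[ab _] [/= Aa Bb]]] := clO (_ `*` _)
  (ex_intro2 _ _ (_, _) (conj Ax By) (fun _ => id)).
by exists (h a).2; split=> //; rewrite ab.
Qed.

Lemma parallelizable_aperiodic :
  parallelizable phi -> rel_diag (orbit_rel (flowJ phi)) = set0.
Proof.
case=> Y _ [h [k [_ _ _ _ hphi]]]; rewrite orbit_rel_flowJE//.
apply/seteqP; split=> // x [t /= t1]; rewrite graphE => xE.
by have := hphi t x; rewrite -xE => /(congr1 fst) /=; lra.
Qed.

Lemma wandering_parallelizable :
  is_space X -> closed (orbit_rel (flow_sym phi)) ->
  rel_diag (nonwandering_rel (flowJ phi)) = set0 -> parallelizable phi.
Proof.
move=> spaceX cO wandering.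
have [L cL LD] := proper_flow_equivariant_fun spaceX phiF
  (wandering_proper phiF cO wandering).
exact: equivariant_fun_parallelizable cL LD.
Qed.

End closed_orbit_relations.

(** * Assembly of the two cycles of implications *)

Theorem theorem0p5 (R : realType) (X : topologicalType) (phi : R -> X -> X)
    (spaceX : is_space X) (phi_flow : is_flow phi) :
  (* part (a) *)
  ([<-> closed (orbit_rel (flowI phi));
        closed (orbit_rel (flowJ phi));
        orbit_rel (flowI phi) = nonwandering_rel (flowI phi);
        orbit_rel (flowI phi) = gen_recurrent_rel (flowI phi);
        orbit_rel (flowJ phi) = gen_recurrent_rel (flowJ phi)]
   /\ (closed (orbit_rel (flowI phi)) -> closed (orbit_rel (flow_sym phi)))
   /\ (closed (orbit_rel (flow_sym phi)) <->
       orbit_rel (flow_sym phi) = gen_recurrent_rel (flow_sym phi)))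
  /\
  (* part (b) *)
  [<-> closed (orbit_rel (flowI phi)) /\ rel_diag (orbit_rel (flowJ phi)) = set0;
       closed (orbit_rel (flowI phi)) /\
         rel_diag (nonwandering_rel (flowJ phi)) = set0;
       closed (orbit_rel (flowI phi)) /\
         rel_diag (gen_recurrent_rel (flowJ phi)) = set0;
       closed (orbit_rel (flow_sym phi)) /\
         rel_diag (nonwandering_rel (flowJ phi)) = set0;
       parallelizable phi].
Proof.
have IJ := closed_orbit_flowJ phi_flow.
have symI := closed_orbit_flow_sym phi_flow.
(* With [JN] below, closedness makes the orbit, nonwandering and generalized recurrent relations of
   [flowJ] coincide, so the three diagonal conditions of part (b) become one. *)
have JG : closed (orbit_rel (flowI phi)) ->
    orbit_rel (flowJ phi) = gen_recurrent_rel (flowJ phi).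
  by move=> /IJ/orbit_rel_closedP.
have JN : closed (orbit_rel (flowI phi)) ->
    orbit_rel (flowJ phi) = nonwandering_rel (flowJ phi).
  by move=> /IJ/closure_id.
split; [split; [|split]|].
- tfae.
  + exact: IJ.1.
  + by move=> /IJ/closure_id.
  + by move=> IN; apply/orbit_rel_closedP; rewrite IN; exact: closed_closure.
  + by move=> /orbit_rel_closedP.
  + by move=> /orbit_rel_closedP/IJ.
- exact: symI.
- exact: orbit_rel_closedP.
- tfae.
  + by move=> [cO O0]; split=> //; rewrite -JN.
  + by move=> [cO N0]; split=> //; rewrite -JG// JN.
  + by move=> [cO G0]; split; [exact: symI|rewrite -JN// JG].
  + by move=> [cO N0]; exact: wandering_parallelizable.
  + move=> par; split; first exact: parallelizable_closed_orbit.
    exact: parallelizable_aperiodic.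
Qed.
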